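(* Let $A=(a_1,\dots,a_n)$ be a finite sequence of real numbers with $a_i\in[0,1]$ for every $i\in[n]$, and let $k$ be a positive integer. Then there is a partition of $A$ into $k$ blocks $B_1,\dots,B_k$ such that $\max_{i\in[k]} b_i \le \min_{i\in[k]} b_i + 1$, where $b_i$ is the size of $B_i$.
   Context: $[k]=\{1,\dots,k\}$. A block of a sequence $(a_1,\dots,a_n)$ is either the empty set or a set of consecutive terms $\{a_i,a_{i+1},\dots,a_j\}$ with $i\le j$. The size of a block is the sum of its elements (the empty block has size $0$). A partition of $A$ into $k$ blocks is an ordered tuple $(B_1,\dots,B_k)$ given by integers $0=x_0\le x_1\le\dots\le x_k=n$ with $B_i=\{a_j: x_{i-1}<j\le x_i\}$; so every term belongs to exactly one block, the blocks appear in order along the sequence, and empty blocks are allowed. *)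

(* Defs.v *)
From mathcomp Require Import all_boot all_order all_algebra.
From mathcomp Require Import reals.

Set Implicit Arguments.
Unset Strict Implicit.
Unset Printing Implicit Defensive.

Import Order.TTheory GRing.Theory Num.Theory.
Local Open Scope ring_scope.

(* The terms a_1, ..., a_n are a 0, ..., a (n - 1) for a : 'I_n -> R. A block
   is represented by the set of the indices of its terms, so that equal terms
   at different positions are kept apart. *)

(* With the indices starting from 0, the condition x_(i-1) < j <= x_i reads
   x i <= j < x i.+1. The cut points need not be distinct, so blocks may be
   empty. *)
Definition block_partition (n k : nat) (B : 'I_k -> {set 'I_n}) : Prop :=
  exists x : nat -> nat,
    [/\ x 0%N = 0%N, x k = n,
        forall i : 'I_k, (x i <= x i.+1)%N
      & forall i : 'I_k, B i = [set j : 'I_n | (x i <= j < x i.+1)%N]].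

Definition block_size (R : realType) (n : nat) (a : 'I_n -> R)
    (S : {set 'I_n}) : R :=
  \sum_(j in S) a j.

(* The value at index 0, which exists because 0 < k, is the initial value of
   the iterated maximum and minimum. *)
Definition max_value (R : realType) (k : nat) (k_gt0 : (0 < k)%N)
    (b : 'I_k -> R) : R :=
  \big[Num.max/b (Ordinal k_gt0)]_(i < k) b i.

Definition min_value (R : realType) (k : nat) (k_gt0 : (0 < k)%N)
    (b : 'I_k -> R) : R :=
  \big[Num.min/b (Ordinal k_gt0)]_(i < k) b i.

(* Main.v *)
Require Import Defs.
From mathcomp Require Import all_boot all_order all_algebra.
From mathcomp Require Import reals.
From mathcomp Require Import lra.

Import Order.TTheory GRing.Theory Num.Theory.
Local Open Scope ring_scope.

(** Let [S] be the sequence of partial sums, and let [t] be the maximum, over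
    all partitions into [k] blocks, of the size of the smallest block, attained
    at the cut points [y].  Let [z] be the cut points obtained by greedily
    taking blocks as long as possible of size at most [t + 1].  As long as [z]
    has not reached [n], its blocks have size greater than [t], because the
    terms are at most [1]; hence [z k = n], since otherwise moving the last cut
    point to [n] would contradict the maximality of [t].  The blocks of
    [minn (y i) (z i)] still have size at least [t], so one may choose
    [x k = n], [x (k - 1)], ..., [x 0] backwards with
    [minn (y i) (z i) <= x i <= z i] and all block sizes in [[t, t + 1]], by a
    discrete intermediate value argument. *)

Definition cuts (m k : nat) (x : nat -> nat) : Prop :=
  [/\ x 0%N = 0%N, x k = m & forall i, (i < k)%N -> (x i <= x i.+1)%N].

Lemma cuts_le_end m k x i : cuts m k x -> (i <= k)%N -> (x i <= m)%N.
Proof.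
case=> _ <- xS; elim: k xS => [|k IHk] xS; first by rewrite leqn0 => /eqP->.
rewrite leq_eqVlt => /predU1P[-> //|]; rewrite ltnS => le_ik.
apply: leq_trans (xS _ (ltnSn k)); apply: IHk le_ik => j lt_jk.
exact/xS/ltnW.
Qed.

Section BoundedIncrements.

Variables (R : realDomainType) (S : nat -> R).
Hypotheses (S_le : {homo S : m p / (m <= p)%N >-> m <= p})
           (S_step : forall m, S m.+1 <= S m + 1).

(** The empty maximum is 0, so the value is meaningful only once some index up to [hi] is known to
    qualify; [lo] plays this part in [last_leP]. *)
Definition last_le (hi : nat) (c : R) : nat :=
  \max_(q < hi.+1 | S q <= c) q.

Lemma last_leP lo hi c : (lo <= hi)%N -> S lo <= c ->
  [/\ (lo <= last_le hi c <= hi)%N, S (last_le hi c) <= c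
    & (last_le hi c < hi)%N -> c < S (last_le hi c).+1].
Proof.
move=> le_lohi le_Slo; rewrite /last_le.
pose A := [pred q : 'I_hi.+1 | S q <= c].
have lo_in : Ordinal (le_lohi : (lo < hi.+1)%N) \in A by [].
have A_gt0 : (0 < #|A|)%N by apply/card_gt0P; eexists; apply: lo_in.
have [q le_Sq maxE] := eq_bigmax_cond (fun q : 'I_hi.+1 => nat_of_ord q) A_gt0.
have le_max (p : 'I_hi.+1) : S p <= c -> (p <= q)%N.
  by move=> le_Sp; rewrite -maxE; apply: leq_bigmax_cond.
rewrite maxE; split=> //.
  by rewrite (le_max _ lo_in) -ltnS ltn_ord.
move=> lt_qhi; rewrite ltNge; apply/negP => le_SqS.
by have := le_max (Ordinal (lt_qhi : (q.+1 < hi.+1)%N)) le_SqS; rewrite ltnn.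
Qed.

(** Induction on [k]. The end point [m] is kept arbitrary between [y k] and [z k], so that the
    induction hypothesis applies to whichever cut point [p] is chosen just before [m]. *)
Lemma cuts_between (t : R) (y z : nat -> nat) k m :
    0 <= t -> y 0%N = 0%N -> z 0%N = 0%N -> (forall i, (y i <= z i)%N) ->
    (forall i, (i < k)%N -> (y i <= y i.+1)%N) ->
    (forall i, (i < k)%N -> S (y i) + t <= S (y i.+1)) ->
    (forall i, (i < k)%N -> S (z i.+1) <= S (z i) + t + 1) ->
    (y k <= m <= z k)%N ->
  exists2 x, cuts m k x
    & forall i, (i < k)%N -> t <= S (x i.+1) - S (x i) <= t + 1.
Proof.
move=> t_ge0 y0 z0 le_yz; elim: k m => [|k IHk] m yS Sy Sz /andP[le_ym le_mz].
  have -> : m = 0%N by apply/eqP; rewrite -leqn0 -z0.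
  by exists (fun=> 0%N).
have le_lohi : (y k <= minn (z k) m)%N.
  by rewrite leq_min le_yz (leq_trans (yS k (ltnSn k))).
have le_Slo : S (y k) <= S m - t.
  by rewrite lerBrDr (le_trans (Sy k (ltnSn k))) // S_le.
have := last_leP _ _ _ le_lohi le_Slo.
set p := last_le _ _ => -[/andP[le_yp]].
rewrite leq_min => /andP[le_pz le_pm] le_Sp lt_Sp.
(* Three reasons can stop [p]: the next index overshoots [S m - t], by an increment of at most 1; or
   [p] is [z k], and [Sz] bounds the last block; or [p] is [m], and that block is empty. *)
have ge_Sp : S m <= S p + t + 1.
  have [lt_p|] := ltnP p (minn (z k) m).
    by have := lt_Sp lt_p; have := S_step p; lra.
  rewrite geq_min => /orP[le_zp|le_mp].
    by have := S_le _ _ le_zp; have := S_le _ _ le_mz; have := Sz k (ltnSn k); lra.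
  by have := S_le _ _ le_mp; lra.
have [| | | |x [x0 xk xS] Sx] := IHk p.
- by move=> i lt_ik; apply/yS/ltnW.
- by move=> i lt_ik; apply/Sy/ltnW.
- by move=> i lt_ik; apply/Sz/ltnW.
- by rewrite le_yp.
exists (fun i => if (i <= k)%N then x i else m).
  split=> [|| i]; rewrite ?leq0n ?ltnn // ltnS => le_ik; rewrite le_ik.
  by case: ltnP => [/xS //|le_ki]; rewrite (_ : i = k) ?xk //; apply/anti_leq/andP.
move=> i; rewrite ltnS => le_ik; rewrite le_ik.
case: ltnP => [/Sx //|le_ki]; rewrite (_ : i = k); last exact/anti_leq/andP.
by rewrite xk; lra.
Qed.

(** The maximum is attained because only the values at indices up to [k] matter and these are at
    most [n]: cut points are encoded as functions between finite types. *)
Lemma max_min_cuts n k : (0 < k)%N ->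
  exists t y, [/\ 0 <= t, cuts n k y,
      forall i, (i < k)%N -> S (y i) + t <= S (y i.+1)
    & forall x, cuts n k x ->
        exists2 i, (i < k)%N & S (x i.+1) <= S (x i) + t].
Proof.
move=> k_gt0; pose i0 := Ordinal k_gt0.
pose gap (x : nat -> nat) (i : 'I_k) := S (x i.+1) - S (x i).
pose minblock x := \big[Num.min/gap x i0]_(i < k) gap x i.
pose seq_of (f : {ffun 'I_k.+1 -> 'I_n.+1}) i : nat := f (inord i).
pose is_cuts (f : {ffun 'I_k.+1 -> 'I_n.+1}) := [&& seq_of f 0%N == 0%N,
  seq_of f k == n & [forall i : 'I_k, seq_of f i <= seq_of f i.+1]%N].
have is_cutsP f : reflect (cuts n k (seq_of f)) (is_cuts f).
  apply: (iffP and3P) => [[/eqP f0 /eqP fk /forallP fS]|[f0 fk fS]].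
    by split=> // i lt_ik; apply: (fS (Ordinal lt_ik)).
  by split; [exact/eqP | exact/eqP | apply/forallP => i; apply: fS].
pose ffun_of (x : nat -> nat) : {ffun 'I_k.+1 -> 'I_n.+1} := [ffun i : 'I_k.+1 => inord (x i)].
have ffun_ofK x i : cuts n k x -> (i <= k)%N -> seq_of (ffun_of x) i = x i.
  move=> cx le_ik; rewrite /seq_of ffunE inordK // inordK //.
  exact: cuts_le_end cx le_ik.
have cuts_ffun x : cuts n k x -> is_cuts (ffun_of x).
  move=> cx; have [x0 xk xS] := cx; apply/is_cutsP.
  split=> [||i lt_ik]; rewrite !ffun_ofK //; [exact: xS | exact: ltnW].
(* A candidate is needed for the maximum to exist: here the last block takes all the terms. *)
have c0 : cuts n k (fun i => if i == k then n else 0%N).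
  split; rewrite ?eqxx //; first by rewrite (ltn_eqF k_gt0).
  by move=> i lt_ik; rewrite (ltn_eqF lt_ik).
have [f /is_cutsP cf f_max] :=
  arg_maxP (fun f => minblock (seq_of f)) (cuts_ffun _ c0).
exists (minblock (seq_of f)), (seq_of f); have [_ _ fS] := cf; split=> //.
- by apply: le_bigmin => [|i _]; rewrite subr_ge0 S_le ?fS.
- move=> i lt_ik; rewrite addrC -lerBrDr.
  exact: (bigmin_le_cond _ (gap (seq_of f)) (isT : xpredT (Ordinal lt_ik))).
move=> x cx; have [/existsP[i le_i]|/existsPn gt_min] := boolP
    [exists i : 'I_k, S (x i.+1) <= S (x i) + minblock (seq_of f)].
  by exists i.
have lt_gap i : minblock (seq_of f) < gap (seq_of (ffun_of x)) i.
  rewrite /gap !ffun_ofK //; last exact: ltnW.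
  by have := gt_min i; rewrite -ltNge; lra.
have := f_max _ (cuts_ffun _ cx); rewrite /= leNgt => /negP[].
by apply: lt_bigmin.
Qed.

Lemma exists_balanced_cuts n k : (0 < k)%N ->
  exists t x, cuts n k x /\
    forall i, (i < k)%N -> t <= S (x i.+1) - S (x i) <= t + 1.
Proof.
move=> k_gt0; have [t [y [t_ge0 cy Sy t_max]]] := max_min_cuts n _ k_gt0.
have [y0 yk yS] := cy; exists t.
pose z := fix z i := if i is j.+1 then last_le n (S (z j) + t + 1) else 0%N.
have z_le_n i : (z i <= n)%N.
  case: i => [//|i]; apply/bigmax_leqP => q _; rewrite -ltnS.
  exact: ltn_ord.
have zP i := last_leP _ _ (S (z i) + t + 1) (z_le_n i)
  ltac:(by rewrite -addrA lerDl addr_ge0).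
have zS i : (z i <= z i.+1)%N by have [/andP[]] := zP i.
have Sz i : S (z i.+1) <= S (z i) + t + 1 by have [] := zP i.
have Sz_gt i : (z i.+1 < n)%N -> S (z i) + t < S (z i.+1).
  by have [_ _ lt_z /lt_z] := zP i; have := S_step (z i.+1); rewrite /=; lra.
have z_homo : {homo z : i j / (i <= j)%N} by apply: homo_leq leq_trans zS.
have zk : z k = n.
  apply/eqP; rewrite eqn_leq z_le_n leqNgt; apply/negP => lt_zk.
  pose x i := if i == k then n else z i.
  have cx : cuts n k x.
    split; rewrite /x ?eqxx //; first by rewrite (ltn_eqF k_gt0).
    by move=> i lt_ik; rewrite (ltn_eqF lt_ik); case: eqP.
  have [i lt_ik] := t_max x cx; rewrite leNgt => /negP[].
  have lt_zi : (z i.+1 < n)%N by apply: leq_ltn_trans (z_homo _ _ lt_ik) lt_zk.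
  rewrite /x (ltn_eqF lt_ik) (lt_le_trans (Sz_gt _ lt_zi)) //.
  by case: eqP => // _; rewrite S_le.
have [|||||||x cx Sx] := cuts_between t (fun i => minn (y i) (z i)) z k n t_ge0.
- by rewrite y0.
- by [].
- by move=> i; apply: geq_minr.
- move=> i lt_ik; rewrite leq_min !geq_min yS //=.
  by rewrite zS orbT.
(* The block of the minimum ends where a block of [y] or of [z] ends and starts no later than it. In
   the second case [z i.+1 < y i.+1 <= n], so the greedy block exceeds [t]. *)
- move=> i lt_ik; have [le_yz|lt_zy] := leqP (y i.+1) (z i.+1).
    apply: le_trans (Sy i lt_ik); rewrite lerD2r.
    exact/S_le/geq_minl.
  apply: le_trans (ltW (Sz_gt i _)); first by rewrite lerD2r; exact/S_le/geq_minr.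
  exact: leq_trans lt_zy (cuts_le_end _ _ _ _ cy lt_ik).
- by move=> i _; apply: Sz.
- by rewrite yk zk minnn leqnn.
by exists x.
Qed.

End BoundedIncrements.

Section PartialSums.

Variables (R : realType) (n : nat) (a : 'I_n -> R).

(** Constant from [n] on, so that monotonicity and the increment bound hold on all of [nat]. *)
Definition partial_sum (m : nat) : R := \sum_(j < n | (j < m)%N) a j.

Lemma block_sizeE p q : (p <= q)%N ->
  block_size a [set j : 'I_n | (p <= j < q)%N] = partial_sum q - partial_sum p.
Proof.
move=> le_pq; rewrite /partial_sum (bigID (fun j : 'I_n => (j < p)%N)) /=.
rewrite (eq_bigl (fun j : 'I_n => (j < p)%N)) => [|j]; last first.
  by apply: andb_idl => /leq_trans; apply.
rewrite addrC addrK /block_size; apply: eq_bigl => j.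
by rewrite inE -leqNgt andbC.
Qed.

Hypothesis a_01 : forall i : 'I_n, 0 <= a i <= 1.

Lemma partial_sum_le : {homo partial_sum : p q / (p <= q)%N >-> p <= q}.
Proof.
move=> p q le_pq; rewrite -subr_ge0 -block_sizeE //.
by apply: sumr_ge0 => j _; case/andP: (a_01 j).
Qed.

Lemma partial_sumS_le m : partial_sum m.+1 <= partial_sum m + 1.
Proof.
rewrite -lerBlDl -block_sizeE // /block_size.
have [lt_mn|le_nm] := ltnP m n.
  rewrite (big_pred1 (Ordinal lt_mn)); first by case/andP: (a_01 (Ordinal lt_mn)).
  by move=> j; rewrite inE ltnS -eqn_leq eq_sym.
rewrite big1 ?ler01 // => j; rewrite inE => /andP[le_mj _].
by have := leq_trans (ltn_ord j) (leq_trans le_nm le_mj); rewrite ltnn.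
Qed.

End PartialSums.

Theorem theorem2p1 (R : realType) (n : nat) (a : 'I_n -> R)
    (a_01 : forall i : 'I_n, 0 <= a i <= 1)
    (k : nat) (k_gt0 : (0 < k)%N) :
  exists B : 'I_k -> {set 'I_n},
    block_partition B /\
    max_value k_gt0 (fun i => block_size a (B i)) <=
      min_value k_gt0 (fun i => block_size a (B i)) + 1.
Proof.
have [t [x [[x0 xk xS] Sx]]] := exists_balanced_cuts _ _
  (partial_sum_le _ _ _ a_01) (partial_sumS_le _ _ _ a_01) n _ k_gt0.
exists (fun i => [set j : 'I_n | (x i <= j < x i.+1)%N]); split.
  by exists x; split=> // i; apply: xS.
have sizeP (i : 'I_k) :
    t <= block_size a [set j : 'I_n | (x i <= j < x i.+1)%N] <= t + 1.
  by rewrite block_sizeE ?Sx ?xS.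
apply: (@le_trans _ _ (t + 1)).
  (* The first case is the initial value of the iteration, itself a block size. *)
  by apply: bigmax_le => [|i _]; [case/andP: (sizeP (Ordinal k_gt0)) |
                                  case/andP: (sizeP i)].
by rewrite lerD2r; apply: le_bigmin => [|i _];
  [case/andP: (sizeP (Ordinal k_gt0)) | case/andP: (sizeP i)].
Qed.
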